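(* Let $X$ be a finite non-empty set, and let $\mathscr R(X)$ be the ring of rational non-commutative power series over $\mathbb Z$ in the variables $X$. Then the Jacobson radical $J(\mathscr R(X))$, with its ring addition $+$ and the operation $a\circ b=a+ab+b$, together with the inclusion of $X$, is the free two-sided skew brace of abelian type on $X$.
   Context: A (left) skew brace is a triple $(B,+,\circ)$ with $(B,+)$ and $(B,\circ)$ groups such that $a\circ(b+c)=a\circ b-a+a\circ c$ for all $a,b,c$; it is two-sided if also $(b+c)\circ a=b\circ a-a+c\circ a$, and of abelian type if $(B,+)$ is abelian. Two-sided skew braces of abelian type are the same as radical rings (non-unital rings $R$ with $J(R)=R$): $a\circ b=a+ab+b$ where $ab$ is the ring product. The free object on $X$ is a member $F$ with a map $i\colon X\to F$ such that each map from $X$ to a two-sided skew brace of abelian type $K$ factors as $\varphi\circ i$ for a unique skew brace homomorphism $\varphi\colon F\to K$. $\mathbb Z\{\{X\}\}$ is the ring of formal power series over $\mathbb Z$ in the non-commuting variables $X$. Let $M$ be the set of monomials (words, including $1$) in $X$. For $m\in M$, the $\mathbb Z$-linear operator $\frac{d}{dm}$ on $\mathbb Z\{\{X\}\}$ is defined (coefficientwise) by sending a monomial $w$ to $u$ if $w=mu$ and to $0$ if $m$ is not a prefix of $w$. A series $f$ is rational if the $\mathbb Z$-module $\mathbb Z[\frac{d}{dm}\mid m\in M]\,f$ is finitely generated. The rational series form a ring $\mathscr R(X)$ containing $X$. *)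

(* Defs.v *)
From HB Require Import structures.
From mathcomp Require Import all_boot all_order all_algebra.
From mathcomp Require Import ring_quotient boolp classical_sets functions.

Set Implicit Arguments.
Unset Strict Implicit.
Unset Printing Implicit Defensive.

Import Order.TTheory GRing.Theory Num.Theory.
Local Open Scope ring_scope.
Local Open Scope classical_set_scope.

Definition group_law (T : Type) (op : T -> T -> T) (e : T) (inv : T -> T) :=
  [/\ associative op, left_id e op, right_id e op,
      left_inverse e inv op & right_inverse e inv op].

Record skewBrace := SkewBrace {
  sb_sort :> Type;
  sb_add : sb_sort -> sb_sort -> sb_sort;
  sb_zero : sb_sort;
  sb_opp : sb_sort -> sb_sort;
  sb_circ : sb_sort -> sb_sort -> sb_sort;
  sb_one : sb_sort;
  sb_inv : sb_sort -> sb_sort;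
  sb_add_group : group_law sb_add sb_zero sb_opp;
  sb_circ_group : group_law sb_circ sb_one sb_inv;
  sb_circDr : forall a b c,
    sb_circ a (sb_add b c) =
    sb_add (sb_add (sb_circ a b) (sb_opp a)) (sb_circ a c)
}.

Definition two_sided (B : skewBrace) := forall a b c : B,
  sb_circ (sb_add b c) a =
  sb_add (sb_add (sb_circ b a) (sb_opp a)) (sb_circ c a).

Definition abelian_type (B : skewBrace) := commutative (@sb_add B).

Definition skewBrace_hom (B C : skewBrace) (phi : B -> C) :=
  {morph phi : a b / sb_add a b >-> sb_add a b} /\
  {morph phi : a b / sb_circ a b >-> sb_circ a b}.

Definition free_two_sided_abelian (X : Type) (F : skewBrace) (i : X -> F) :=
  [/\ two_sided F, abelian_type F &
      forall K : skewBrace, two_sided K -> abelian_type K ->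
      forall f : X -> K,
      exists! phi : F -> K, skewBrace_hom phi /\ f = phi \o i].

(* [idealr_closed I] says that [I] is a proper left ideal. *)
Definition maximal_left_ideal (R : nzRingType) (I : {pred R}) :=
  idealr_closed I /\
  forall K : {pred R}, idealr_closed K -> {subset I <= K} -> {subset K <= I}.

Definition jacobson (R : nzRingType) : set R :=
  [set a | forall I : {pred R}, maximal_left_ideal I -> a \in I].
Arguments jacobson R : clear implicits.

Section JacobsonTheory.
Variable R : nzRingType.
Implicit Types a b r : R.

Lemma jacobson0 : jacobson R 0.
Proof. by move=> I [[]]. Qed.

Lemma jacobson_lin r a b : jacobson R a -> jacobson R b -> jacobson R (r * a + b).
Proof.
by move=> Ja Jb I mI; case: (mI) => -[_ _ lin] _; apply: lin; [apply: Ja|apply: Jb].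
Qed.

Lemma jacobsonD a b : jacobson R a -> jacobson R b -> jacobson R (a + b).
Proof. by rewrite -{2}(mul1r a); apply: jacobson_lin. Qed.

Lemma jacobsonM r a : jacobson R a -> jacobson R (r * a).
Proof. by move=> Ja; rewrite -[r * a]addr0; apply: jacobson_lin => //; apply: jacobson0. Qed.

Lemma jacobsonN a : jacobson R a -> jacobson R (- a).
Proof. by rewrite -mulN1r; apply: jacobsonM. Qed.

Lemma maximal_left_ideal_exists (I : {pred R}) :
  idealr_closed I -> exists2 M, maximal_left_ideal M & {subset I <= M}.
Proof.
move=> iI; pose M_ (A : set R) : {pred R} := fun x => x \in A.
have M_E (A : set R) x : (x \in M_ A) = (x \in A) by [].
have M_P (K : {pred R}) : M_ [set x | x \in K] = K.
  by apply/funext => y; rewrite /M_; apply/idP/idP => [/set_mem//|Ix]; apply/mem_set.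
pose P (A : set R) := A = set0 \/ idealr_closed (M_ A) /\ {subset I <= M_ A}.
have [F FP Ftot|A [PA Amax]] := @Zorn_bigcup R P.
  case: (pselect (exists2 A, F A & A !=set0)) => [[A FA A0]|noA]; last first.
    left; apply/seteqP; split=> // x [A FA Ax].
    by apply: noA; exists A => //; exists x.
  have FI B : F B -> B !=set0 -> idealr_closed (M_ B) /\ {subset I <= M_ B}.
    by move=> /FP[->|//] [].
  right; split.
    split.
    - by apply/mem_set; exists A => //; have [[/set_mem]] := FI _ FA A0.
    - apply/negP => /set_mem[B FB B1].
      have [|[_ /negP nB1 _] _] := FI _ FB; first by exists 1.
      by apply: nB1; apply/mem_set.
    - move=> a u v /set_mem[B FB Bu] /set_mem[C FC Cv]; apply/mem_set.
      have [|[_ _ linB] _] := FI _ FB; first by exists u.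
      have [|[_ _ linC] _] := FI _ FC; first by exists v.
      have [BC|CB] := Ftot _ _ FB FC.
        by exists C => //; apply/set_mem/linC; apply/mem_set => //; apply: BC.
      by exists B => //; apply/set_mem/linB; apply/mem_set => //; apply: CB.
  move=> x Ix; apply/mem_set; exists A => //.
  by have [_ /(_ x Ix)/set_mem] := FI _ FA A0.
have {}PA : idealr_closed (M_ A) /\ {subset I <= M_ A}.
  case: PA => // A0; exfalso; have PI : P [set x | x \in I].
    by right; rewrite M_P; split.
  apply: (Amax _ _ PI); rewrite A0; split=> [x //|/(_ 0)]; apply.
  by case: iI.
exists (M_ A); last by case: PA.
split; first by case: PA.
move=> K iK AK x Kx; apply: contrapT => nAx.
apply: (Amax [set x | x \in K]).
  split=> [y Ay|sKA]; first by apply: AK; apply/mem_set.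
  by apply: nAx; apply/mem_set/sKA.
by right; rewrite M_P; split=> // y Iy; apply/AK; apply: (PA.2).
Qed.

Lemma jacobson_linv a : jacobson R a -> exists2 c, jacobson R c & c * a + c + a = 0.
Proof.
move=> Ja; pose I : {pred R} := [pred x | `[< exists r, x = r * (1 + a) >]].
have [[b b1]|nb] := pselect (exists b, b * (1 + a) = 1).
  exists (- (b * a)); first exact/jacobsonN/jacobsonM.
  have ba : - (b * a) = b - 1 by rewrite -b1 mulrDr mulr1 opprD addrA subrr sub0r.
  rewrite -[X in _ + X + a]mulr1 -mulrDr ba [a + 1]addrC mulrBl b1 mul1r.
  by rewrite opprD addrA subrr sub0r addNr.
have iI : idealr_closed I.
  split.
  - by apply/asboolP; exists 0; rewrite mul0r.
  - by apply/asboolPn => -[r r1]; apply: nb; exists r.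
  - move=> r u v /asboolP[s ->] /asboolP[t ->]; apply/asboolP.
    by exists (r * s + t); rewrite mulrDl mulrA.
have [M mM IM] := maximal_left_ideal_exists iI.
have [[M0 M1 linM] _] := mM.
have Ma : a \in M by apply: Ja.
have M1a : 1 + a \in M by apply: IM; apply/asboolP; exists 1; rewrite mul1r.
case/negP: M1; rewrite (_ : 1 = - 1 * a + (1 + a)); first exact: linM.
by rewrite mulN1r addrCA addNr addr0.
Qed.

Lemma jacobson_inv a : jacobson R a ->
  exists c, [/\ jacobson R c, c + c * a + a = 0 & a + a * c + c = 0].
Proof.
move=> Ja; have [c Jc ca] := jacobson_linv Ja; have [d Jd dc] := jacobson_linv Jc.
have oneE (x y : R) : y * x + y + x = 0 -> (1 + y) * (1 + x) = 1.
  move=> yx; rewrite mulrDl mul1r mulrDr mulr1 -addrA [x + _]addrC.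
  by rewrite [y + _]addrC yx addr0.
have ca1 := oneE _ _ ca; have dc1 := oneE _ _ dc.
have da : 1 + d = 1 + a.
  by have := mulrA (1 + d) (1 + c) (1 + a); rewrite ca1 dc1 mulr1 mul1r.
have {}da : d = a by apply: addrI da.
exists c; split=> //; first by rewrite [c + _]addrC.
by rewrite -da [d + _]addrC.
Qed.

Let J := set_type (jacobson R).

Definition jacobson_sub a (Ja : jacobson R a) : J := exist _ a (mem_set Ja).

Lemma jacobson_val (a : J) : jacobson R (val a).
Proof. exact: set_mem (valP a). Qed.

Definition jacobson_add (a b : J) : J :=
  jacobson_sub (jacobsonD (jacobson_val a) (jacobson_val b)).

Definition jacobson_opp (a : J) : J := jacobson_sub (jacobsonN (jacobson_val a)).

Definition jacobson_zero : J := jacobson_sub jacobson0.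

Definition jacobson_circ (a b : J) : J := jacobson_sub
  (jacobsonD (jacobsonD (jacobson_val a) (jacobsonM (val a) (jacobson_val b)))
             (jacobson_val b)).

Definition jacobson_cinv (a : J) : J :=
  let: exist c Jc := cid (jacobson_inv (jacobson_val a)) in
  jacobson_sub (let: And3 Jc _ _ := Jc in Jc).

Lemma jacobson_add_group : group_law jacobson_add jacobson_zero jacobson_opp.
Proof.
split=> [a b c|a|a|a|a]; apply: val_inj => /=; first exact: addrA.
- exact: add0r.
- exact: addr0.
- exact: addNr.
- exact: subrr.
Qed.

Lemma circ_shift a b : 1 + (a + a * b + b) = (1 + a) * (1 + b).
Proof. by rewrite mulrDl mul1r mulrDr mulr1 -addrA [a * b + b]addrC addrA addrACA addrA. Qed.

Lemma jacobson_circ_group : group_law jacobson_circ jacobson_zero jacobson_cinv.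
Proof.
split=> [a b c|a|a|a|a]; apply: val_inj => /=.
- by apply: (@addrI _ 1); rewrite !circ_shift mulrA.
- by rewrite mul0r !add0r.
- by rewrite mulr0 !addr0.
- by rewrite /jacobson_cinv; case: cid => c [].
- by rewrite /jacobson_cinv; case: cid => c [].
Qed.

Lemma jacobson_circDr (a b c : J) : jacobson_circ a (jacobson_add b c) =
  jacobson_add (jacobson_add (jacobson_circ a b) (jacobson_opp a)) (jacobson_circ a c).
Proof.
apply: val_inj => /=; set x := val a; set y := val b; set z := val c.
rewrite mulrDr -[x + x * z + z]addrA [RHS]addrA subrK.
by rewrite -!addrA; congr (_ + (_ + _)); rewrite addrCA.
Qed.

Definition jacobson_brace : skewBrace :=
  SkewBrace jacobson_add_group jacobson_circ_group jacobson_circDr.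

End JacobsonTheory.

(* A series is its family of coefficients, indexed by the words in [X]. *)
Definition ncseries (X : finType) := seq X -> int.

Section Series.
Variable X : finType.
Local Notation series := (ncseries X).
Implicit Types (f g h : series) (u w m : seq X) (x : X).

HB.instance Definition _ := GRing.Zmodule.copy series (seq X -> int).

Definition ncone : series := fun w => (w == [::])%:R.

Definition ncmul f g : series :=
  fun w => \sum_(i < (size w).+1) f (take i w) * g (drop i w).

Definition ncvar x : series := fun w => (w == [:: x])%:R.

(* [u] has in [d/dm f] the coefficient of [m ++ u] in [f]. *)
Definition ncderiv m f : series := fun u => f (m ++ u).

Lemma ncD f g w : (f + g) w = f w + g w. Proof. by []. Qed.
Lemma ncN f w : (- f) w = - f w. Proof. by []. Qed.
Lemma nc0 w : (0 : series) w = 0. Proof. by []. Qed.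

Lemma ncMz f k w : (f *~ k) w = f w * k.
Proof.
have MnE n : (f *+ n) w = f w *+ n.
  by elim: n => [|n IH]; rewrite ?mulr0n ?mulrS // ncD IH.
case: k => n; first by rewrite -pmulrn MnE -mulr_natr natz.
by rewrite NegzE mulrNz -pmulrn ncN MnE mulrN -mulr_natr natz.
Qed.

Lemma ncmul_nil f g : ncmul f g [::] = f [::] * g [::].
Proof. by rewrite /ncmul big_ord_recl big_ord0 addr0. Qed.

Lemma ncmul_cons f g x w :
  ncmul f g (x :: w) = f [::] * g (x :: w) + ncmul (ncderiv [:: x] f) g w.
Proof. by rewrite /ncmul big_ord_recl. Qed.

Lemma ncmulDl : left_distributive ncmul +%R.
Proof.
move=> f g h; apply/funext => w; rewrite ncD /ncmul -big_split /=.
by apply: eq_bigr => i _; rewrite ncD mulrDl.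
Qed.

Lemma ncmulDr : right_distributive ncmul +%R.
Proof.
move=> f g h; apply/funext => w; rewrite ncD /ncmul -big_split /=.
by apply: eq_bigr => i _; rewrite ncD mulrDr.
Qed.

Lemma ncmulMzl f g k : ncmul (f *~ k) g = ncmul f g *~ k.
Proof.
apply/funext => w; rewrite ncMz /ncmul mulr_suml.
by apply: eq_bigr => i _; rewrite ncMz mulrAC.
Qed.

Lemma ncderiv_mul x f g : ncderiv [:: x] (ncmul f g) =
  ncderiv [:: x] g *~ f [::] + ncmul (ncderiv [:: x] f) g.
Proof. by apply/funext => w; rewrite ncD ncMz [LHS]ncmul_cons mulrC. Qed.

Lemma ncmulA : associative ncmul.
Proof.
move=> f g h; apply/funext => w; elim: w f g h => [|x w IH] f g h.
  by rewrite !ncmul_nil mulrA.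
rewrite !ncmul_cons IH ncderiv_mul ncmulDl ncD ncmul_nil ncmulMzl ncMz.
by rewrite mulrDr -!mulrA -addrA [X in _ = _ + (X + _)]mulrC.
Qed.

Lemma ncmul1f : left_id ncone ncmul.
Proof.
move=> f; apply/funext => -[|x w]; first by rewrite ncmul_nil mul1r.
rewrite ncmul_cons /ncmul mul1r big1 ?addr0 // => i _.
by rewrite [ncderiv _ _ _]/= mul0r.
Qed.

Lemma ncmulf1 : right_id ncone ncmul.
Proof.
move=> f; apply/funext => w; elim: w f => [|x w IH] f.
  by rewrite ncmul_nil mulr1.
by rewrite ncmul_cons IH mulr0 add0r.
Qed.

Lemma ncone_neq0 : ncone != 0.
Proof. by apply/eqP => /(congr1 (fun f => f [::])). Qed.

HB.instance Definition _ := GRing.Zmodule_isNzRing.Build series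
  ncmulA ncmul1f ncmulf1 ncmulDl ncmulDr ncone_neq0.

End Series.

(* The ring of operators [Z[d/dm | m]]. *)
Inductive deriv_ring (X : finType) : (ncseries X -> ncseries X) -> Prop :=
| DerivRing_deriv m : deriv_ring (ncderiv m)
| DerivRing_id : deriv_ring id
| DerivRing_sub D E : deriv_ring D -> deriv_ring E -> deriv_ring (fun f => D f - E f)
| DerivRing_comp D E : deriv_ring D -> deriv_ring E -> deriv_ring (D \o E).

Definition fg_Zmodule (V : zmodType) (A : set V) :=
  exists n (s : n.-tuple V), A = [set v | inIntSpan s v].

Definition rational (X : finType) : {pred ncseries X} :=
  [pred f | `[< fg_Zmodule [set D f | D in @deriv_ring X] >]].

Section Zspan.
Variable V : zmodType.
Implicit Types (s t : seq V) (v w x : V) (A : set V).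

Fixpoint zspan s v : Prop :=
  if s is x :: s' then exists k, zspan s' (v - x *~ k) else v = 0.

Lemma zspanP s v : zspan s v <-> inIntSpan (in_tuple s) v.
Proof.
elim: s v => [|x s IH] v /=.
  split=> [->|[a ->]]; last by rewrite big_ord0.
  by exists [ffun=> 0]; rewrite big_ord0.
split=> [[k /IH[a va]]|[a va]].
  exists [ffun i => if unlift ord0 i is Some j then a j else k].
  rewrite big_ord_recl /= ffunE unlift_none -(subrK (x *~ k) v) va addrC.
  by congr (_ + _); apply: eq_bigr => i _; rewrite ffunE liftK.
exists (a ord0); apply/IH; exists [ffun i => a (lift ord0 i)].
rewrite va big_ord_recl /= addrC addKr; apply: eq_bigr => i _.
by rewrite ffunE.
Qed.

Lemma zspan0 s : zspan s 0.
Proof. by elim: s => //= x s IH; exists 0; rewrite mulr0z subr0. Qed.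

Lemma subrMzB v w x (k l : int) :
  v - w - x *~ (k - l) = (v - x *~ k) - (w - x *~ l).
Proof.
rewrite mulrzBr !opprB -!addrA; congr (_ + _).
by rewrite addrCA [RHS]addrCA [- w - _]addrC.
Qed.

Lemma zspanB s v w : zspan s v -> zspan s w -> zspan s (v - w).
Proof.
elim: s v w => [|x s IH] v w /=; first by move=> -> ->; rewrite subr0.
by move=> [k vk] [l wl]; exists (k - l); rewrite subrMzB; apply: IH.
Qed.

Definition zclosed A := A 0 /\ forall v w, A v -> A w -> A (v - w).

Lemma zspan_closed s : zclosed (zspan s).
Proof. by split; [apply: zspan0|apply: zspanB]. Qed.

Lemma zclosedN A v : zclosed A -> A v -> A (- v).
Proof. by move=> [A0 AB] Av; rewrite -sub0r; apply: AB. Qed.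

Lemma zclosedD A v w : zclosed A -> A v -> A w -> A (v + w).
Proof.
by move=> cA Av Aw; rewrite -[w]opprK; apply: (cA.2) => //; apply: zclosedN.
Qed.

Lemma zclosedMz A v k : zclosed A -> A v -> A (v *~ k).
Proof.
move=> cA Av; have An n : A (v *+ n).
  by elim: n => [|n IH]; [rewrite mulr0n; apply: cA.1|rewrite mulrS; apply: zclosedD].
case: k => n; first exact: An.
by rewrite NegzE mulrNz; apply: zclosedN => //; apply: An.
Qed.

Lemma zspan_sub s A : zclosed A -> (forall x, x \in s -> A x) -> zspan s `<=` A.
Proof.
move=> cA; elim: s => [|x s IH] sA v /=; first by move=> ->; apply: cA.1.
move=> [k vk]; rewrite -(subrK (x *~ k) v); apply: zclosedD => //.
  by apply: IH vk => y ys; apply: sA; rewrite inE ys orbT.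
by apply: zclosedMz => //; apply: sA; rewrite inE eqxx.
Qed.

Lemma mem_zspan s v : v \in s -> zspan s v.
Proof.
elim: s => //= x s IH; rewrite inE => /orP[/eqP->|/IH vs].
  by exists 1; rewrite mulr1z subrr; apply: zspan0.
by exists 0; rewrite mulr0z subr0.
Qed.

Lemma int_subgroup (K : set int) : K 0 -> (forall k l, K k -> K l -> K (k - l)) ->
  exists2 d, K d & forall k, K k -> exists q, k = d * q.
Proof.
move=> K0 KB.
have KN k : K k -> K (- k) by move=> Kk; rewrite -sub0r; apply: KB.
have KD k l : K k -> K l -> K (k + l).
  by move=> Kk Kl; rewrite -[l]opprK; apply: KB => //; apply: KN.
have KM k (q : int) : K k -> K (k * q).
  move=> Kk; rewrite -mulrzz; case: q => n.
    by elim: n => [|n IH] //; rewrite -[_ *~ _]/(k *+ n.+1) mulrS; apply: KD.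
  rewrite NegzE mulrNz; apply: KN; elim: n => [|n IH] //.
  by rewrite -[_ *~ _]/(k *+ n.+2) mulrS; apply: KD.
case: (pselect (exists n : nat, `[< K n.+1%:Z >])) => [exK|nK]; last first.
  exists 0 => // k Kk; exists 0; rewrite mulr0.
  case: k Kk => [[|n]|n] // Kn; exfalso; apply: nK; exists n; apply/asboolP => //.
  by rewrite -[_%:Z]opprK -NegzE; apply: KN.
case: (ex_minnP exK) => n /asboolP Kn nmin; exists n.+1%:Z => // k Kk.
exists (k %/ n.+1%:Z)%Z; rewrite {1}(divz_eq k n.+1%:Z) mulrC.
suff -> : (k %% n.+1%:Z)%Z = 0 by rewrite addr0.
have Kr : K (k %% n.+1%:Z)%Z by rewrite /modz; apply: KB => //; rewrite mulrC; apply: KM.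
have := ltz_pmod k (isT : 0 < n.+1%:Z).
have := modz_ge0 k (isT : n.+1%:Z != 0).
case: (modz k n.+1%:Z) Kr => [[|r]|r] //= Kr _; rewrite ltz_nat ltnS => rn.
by have := nmin r; rewrite leqNgt rn => /(_ (introT (asboolP _) Kr)).
Qed.

Lemma zspan_noeth s A : zclosed A -> A `<=` zspan s -> exists t, A = zspan t.
Proof.
elim: s A => [|x s IH] A cA As.
  exists [::]; apply/seteqP; split=> v /=; first exact: As.
  by move=> ->; apply: cA.1.
have [|v [] //|t tE] := IH (A `&` zspan s).
  split; first by split; [apply: cA.1|apply: zspan0].
  by move=> v w [? ?] [? ?]; split; [apply: cA.2|apply: zspanB].
have [||d [vd Avd svd] dmin] :=
    @int_subgroup [set k | exists2 v, A v & zspan s (v - x *~ k)].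
- by exists 0; [apply: cA.1|rewrite mulr0z subr0; apply: zspan0].
- move=> k l [v Av sv] [w Aw sw]; exists (v - w); first exact: cA.2.
  by rewrite subrMzB; apply: zspanB.
exists (vd :: t); apply/seteqP; split=> v.
  move=> Av; have [k vk] := As _ Av.
  have [|q kE] := dmin k; first by exists v.
  exists q; rewrite -tE; split; first by apply: cA.2 => //; apply: zclosedMz.
  have := zspanB vk (zclosedMz q (zspan_closed s) svd).
  by rewrite mulrzBl -mulrzA -kE opprB addrA subrK.
apply: zspan_sub => // y; rewrite inE => /orP[/eqP->//|yt].
by have := mem_zspan yt; rewrite -tE => -[].
Qed.

End Zspan.

Section RationalTheory.
Variable X : finType.
Implicit Types f g : ncseries X.

Lemma ncderivB m f g : ncderiv m (f - g) = ncderiv m f - ncderiv m g.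
Proof. by []. Qed.

Lemma ncderiv_cat m n f : ncderiv n (ncderiv m f) = ncderiv (m ++ n) f.
Proof. by apply/funext => w; rewrite /ncderiv catA. Qed.

Lemma deriv_ring_span (S : set (ncseries X)) D f : zclosed S -> deriv_ring D ->
  (forall m, S (ncderiv m f)) -> forall m, S (ncderiv m (D f)).
Proof.
move=> cS rD; elim: rD f => {D} [n|//|D E _ IHD _ IHE|D E _ IHD _ IHE] f Sf m.
- by rewrite ncderiv_cat.
- by rewrite ncderivB; apply: cS.2; [apply: IHD|apply: IHE].
- by apply: IHD; apply: IHE.
Qed.

Lemma rationalP f :
  f \in @rational X <-> exists s, forall m, zspan s (ncderiv m f).
Proof.
split=> [/asboolP[n [s sE]]|[s sP]].
  exists s => m.
  have : [set D f | D in @deriv_ring X] (ncderiv m f).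
    by exists (ncderiv m) => //; apply: DerivRing_deriv.
  rewrite sE /= => -[a ->]; apply: big_ind => [|u v su sv|i _].
  - exact: zspan0.
  - exact: zclosedD (zspan_closed _) su sv.
  - by apply: zclosedMz; [apply: zspan_closed|apply/mem_zspan/mem_nth; rewrite size_tuple].
have [||t tE] := @zspan_noeth _ s [set D f | D in @deriv_ring X].
- split; last first.
    move=> _ _ [D rD <-] [E rE <-]; exists (fun f => D f - E f) => //.
    exact: DerivRing_sub.
  exists (fun f => id f - id f); last exact: subrr.
  by apply: DerivRing_sub; apply: DerivRing_id.
- move=> _ [D rD <-].
  exact: (@deriv_ring_span _ _ _ (zspan_closed s) rD sP [::]).
apply/asboolP; exists (size t), (in_tuple t); rewrite tE.
by apply/seteqP; split=> v /zspanP.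
Qed.

Lemma zspan_catl (V : zmodType) (s t : seq V) v : zspan s v -> zspan (s ++ t) v.
Proof.
apply: zspan_sub => [|x xs]; first exact: zspan_closed.
by apply: mem_zspan; rewrite mem_cat xs.
Qed.

Lemma zspan_catr (V : zmodType) (s t : seq V) v : zspan t v -> zspan (s ++ t) v.
Proof.
apply: zspan_sub => [|x xs]; first exact: zspan_closed.
by apply: mem_zspan; rewrite mem_cat xs orbT.
Qed.

Lemma ncvar_rational x : ncvar x \in @rational X.
Proof.
apply/rationalP; exists [:: 1; ncvar x].
have c0 := zspan0 [:: 1; ncvar x].
case=> [|y [|z m]].
- by apply: mem_zspan; rewrite !inE eqxx orbT.
- have [->|yx] := eqVneq y x.
    apply: mem_zspan; rewrite !inE; apply/orP; left; apply/eqP/funext => w.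
    by rewrite /ncderiv /ncvar /= eqseq_cons eqxx.
  rewrite (_ : ncderiv _ _ = 0) //; apply/funext => w.
  by rewrite /ncderiv /ncvar /= eqseq_cons (negPf yx).
- rewrite (_ : ncderiv _ _ = 0) //; apply/funext => w.
  by rewrite /ncderiv /ncvar /= eqseq_cons andbF.
Qed.

Lemma rational_subring_closed : subring_closed (@rational X).
Proof.
split.
- apply/rationalP; exists [:: 1] => -[|x m]; first by apply: mem_zspan; rewrite inE.
  by rewrite (_ : ncderiv _ _ = 0) //; apply: zspan0.
- move=> f g /rationalP[s sf] /rationalP[t tg]; apply/rationalP; exists (s ++ t) => m.
  by rewrite ncderivB; apply: zspanB; [apply: zspan_catl|apply: zspan_catr].
- move=> f g /rationalP[s sf] /rationalP[t tg]; apply/rationalP.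
  exists ([seq h * g | h <- s] ++ t) => m.
  have closed := zspan_closed ([seq h * g | h <- s] ++ t).
  elim: m f sf => [|x m IH] f sf.
    apply: zspan_catl; move: (sf [::]); rewrite /ncderiv -[fun u => f _]/f.
    apply: (zspan_sub (A := [set f | zspan _ (f * g)])) => [|h hs /=].
      split=> /=; first by rewrite mul0r; apply: zspan0.
      by move=> u v su sv; rewrite mulrBl; apply: zspanB.
    by apply: mem_zspan; apply: map_f.
  rewrite -cat1s -ncderiv_cat -[f * g]/(ncmul f g) ncderiv_mul.
  rewrite -[ncderiv m _]/(ncderiv m (_ *~ _) + ncderiv m (ncmul _ _)).
  apply: zclosedD => //; last by apply: IH => n; rewrite ncderiv_cat.
  rewrite (_ : ncderiv _ _ = ncderiv ([:: x] ++ m) g *~ f [::]).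
    by apply: zclosedMz => //; apply: zspan_catr.
  by apply/funext => w; rewrite {1}/ncderiv !ncMz /ncderiv catA.
Qed.

HB.instance Definition _ := GRing.isSubringClosed.Build (ncseries X) (@rational X)
  rational_subring_closed.

End RationalTheory.

Record ratseries (X : finType) := RatSeries {
  ratval : ncseries X;
  _ : ratval \in @rational X
}.

HB.instance Definition _ X := [isSub for @ratval X].
HB.instance Definition _ X := [Choice of ratseries X by <:].
HB.instance Definition _ X := [SubChoice_isSubNzRing of ratseries X by <:].

Definition ratvar (X : finType) (x : X) : ratseries X := RatSeries (ncvar_rational x).

(* Main.v *)
(* A rational series [f] is determined by [f = eps f + sum_x x (d_x f)], and its
   derivatives lie in a finitely generated Z-module stable under every [d_x].
   Since the star [1 + p + p^2 + ...] of a proper rational series is rational,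
   the Jacobson radical consists of the series with zero constant term.
   Let [U] be the radical ring [K] with a unit adjoined and [xi x] the image of
   [x]. The extension [Psi] of [X -> K] must satisfy
     [Psi f = eps f + sum_x xi x * Psi (d_x f)].
   On generators of a stable module this is a system [y = v + M y] with [M] over
   the radical ideal [K], which has exactly one solution. Comparing with a
   Z-basis shows that [Psi] respects all Z-linear relations, so it is well defined.
   An additive map with [delta f = sum_x xi x * delta (d_x f)] vanishes for the
   same reason; this gives uniqueness, and multiplicativity of [Psi] with
   [delta f = Psi (f g) - Psi f * Psi g]. *)
Require Import Defs.
From HB Require Import structures.
From mathcomp Require Import all_boot all_algebra.
From mathcomp Require Import zify.
From mathcomp Require Import boolp classical_sets.

Set Implicit Arguments.
Unset Strict Implicit.
Unset Printing Implicit Defensive.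

Import GRing.Theory.
Local Open Scope ring_scope.

(** * Integer relations and linear systems *)

Section IntegerCoefficients.

Notation intr_mx R := (map_mx (intr : int -> R)).

Lemma map_raddf_mul (V W : nzRingType) (h : {additive V -> W}) m n p
    (P : 'M[int]_(m, n)) (u : 'M[V]_(n, p)) :
  map_mx h (intr_mx V P *m u) = intr_mx W P *m map_mx h u.
Proof.
apply/matrixP => i j; rewrite !mxE raddf_sum; apply: eq_bigr => k _.
by rewrite !mxE !mulrzl raddfMz.
Qed.

Definition int_free (V : nzRingType) n (u : 'cV[V]_n) :=
  forall a : 'rV[int]_n, intr_mx V a *m u = 0 -> a = 0.

(* A nontrivial relation [a u = 0] is [g *: delta 0] times a unimodular
   matrix [T] by Smith normal form, so [T u] has a vanishing first entry. *)
Lemma shrink_generators (V : nzRingType) n (u : 'cV[V]_n) (a : 'rV[int]_n) :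
  (forall k (v : V), v *~ k = 0 -> k = 0 \/ v = 0) ->
  a != 0 -> intr_mx V a *m u = 0 ->
  exists m (t : 'cV[V]_m) P Q,
    [/\ (m < n)%N, u = intr_mx V P *m t & t = intr_mx V Q *m u].
Proof.
move=> torsionfree; case: n u a => [|n] u a a0 au.
  by case/eqP: a0; apply/rowP; case.
have [L uL [T uT [d _ aE]]] := int_Smith_normal_form a.
pose D : 'rV[int]_n.+1 := \matrix_(i, j) (d`_i *+ (i == j :> nat)).
pose w := intr_mx V T *m u.
have Dw : intr_mx V D *m w = 0.
  have -> : D = invmx L *m a *m invmx T by rewrite aE !mulmxA mulVmx // mul1mx mulmxK.
  by rewrite /w !map_mxM /= -!mulmxA (mulmxA _ _ u) -map_mxM /= mulVmx // map_mx1 mul1mx au mulmx0.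
have d0 : d`_0 != 0.
  apply: contra_neq a0 => d0; rewrite aE (_ : \matrix_(i, j) _ = 0) ?mulmx0 ?mul0mx //.
  by apply/matrixP => i j; rewrite !mxE ord1 /= d0 mul0rn.
(* [D] has one row, so [Dw] says that a nonzero integer multiple of [w 0 0] vanishes. *)
have w0 : w 0 0 = 0.
  have := congr1 (fun M : 'cV[V]_1 => M 0 0) Dw; rewrite !mxE big_ord_recl big1 => [|i _].
    by rewrite addr0 !mxE /= mulr1n mulrzl => /torsionfree[/eqP|//]; rewrite (negPf d0).
  by rewrite !mxE /= mulr0z mul0r.
(* [S] deletes the first coordinate and [S^T] reinserts it as 0. *)
pose S : 'M[int]_(n, n.+1) := rowsub (lift 0) 1%:M.
have SE : intr_mx V S *m w = rowsub (lift 0) w.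
  by rewrite /S map_mxsub map_mx1 mul_rowsub_mx mul1mx.
exists n, (intr_mx V S *m w), (invmx T *m S^T), (S *m T); split=> //; last first.
  by rewrite map_mxM -mulmxA.
have wE : w = intr_mx V S^T *m (intr_mx V S *m w).
  have Sw k : (intr_mx V S *m w) k 0 = w (lift 0 k) 0 by rewrite SE mxE.
  have SE' k i : intr_mx V S^T i k = (lift 0 k == i)%:R.
    by rewrite !mxE; case: (_ == _).
  apply/colP => i; rewrite [RHS]mxE.
  case: (unliftP 0 i) => [j|] ->.
    rewrite (bigD1 j) //= Sw SE' eqxx mul1r big1 ?addr0 // => k kj.
    by rewrite SE' (inj_eq lift_inj) (negPf kj) mul0r.
  by rewrite w0 big1 // => k _; rewrite SE' mul0r.
by rewrite map_mxM -mulmxA -wE /w mulmxA -map_mxM mulVmx // map_mx1 mul1mx.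
Qed.

(** A generating family of least size has no nontrivial relation, which would shrink it. [Q] keeps
    the basis inside the span of [s]; this is what later carries stability over to [u]. *)
Lemma int_basis (V : nzRingType) n (s : 'cV[V]_n) :
  (forall k (v : V), v *~ k = 0 -> k = 0 \/ v = 0) ->
  exists m (u : 'cV[V]_m) P Q,
    [/\ int_free u, s = intr_mx V P *m u & u = intr_mx V Q *m s].
Proof.
move=> torsionfree.
pose gen m := exists (u : 'cV[V]_m) P Q, s = intr_mx V P *m u /\ u = intr_mx V Q *m s.
have exgen : exists m, `[< gen m >].
  by exists n; apply/asboolP; exists s, 1%:M, 1%:M; rewrite map_mx1 mul1mx.
case: (ex_minnP exgen) => m /asboolP[u [P [Q [sE uE]]]] min_m.
exists m, u, P, Q; split=> // a au; apply/eqP/negPn/negP => a0.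
have [l [t [P' [Q' [ltlm uE' tE]]]]] := shrink_generators torsionfree a0 au.
have /min_m : `[< gen l >]; last by rewrite leqNgt ltlm.
apply/asboolP; exists t, (P *m P'), (Q' *m Q); split.
  by rewrite map_mxM -mulmxA -uE'.
by rewrite map_mxM -mulmxA -uE.
Qed.

End IntegerCoefficients.

Section LinearSystems.
Variables (U : nzRingType) (I : U -> Prop).
Hypothesis ID : forall a b, I a -> I b -> I (a + b).
Hypothesis IMr : forall a b, I a -> I (a * b).
Hypothesis Iinv : forall a, I a -> exists2 b, b * (1 - a) = 1 & (1 - a) * b = 1.

Definition mx_in m n (M : 'M[U]_(m, n)) := forall i j, I (M i j).

(* Gaussian elimination: [1 - a] is invertible for the corner entry [a]. *)
Lemma linear_system n (M : 'M[U]_n) (v : 'cV[U]_n) : mx_in M ->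
  exists! y, y = v + M *m y.
Proof.
elim: n M v => [|n IH] M v MI.
  by exists 0; split=> [|y _]; apply/colP; case.
rewrite -[n.+1]/(1 + n)%N in M v MI *.
rewrite -(submxK M) -(vsubmxK v).
set a := ulsubmx M; set b := ursubmx M; set c := dlsubmx M; set D := drsubmx M.
set v0 := usubmx v; set v1 := dsubmx v.
have [z za az] := Iinv (MI (lshift n 0) (lshift n 0)).
have aE : a = (M (lshift n 0) (lshift n 0))%:M.
  by rewrite [a]mx11_scalar !mxE.
have zaM : z%:M *m (1%:M - a) = 1%:M by rewrite aE -raddfB /= -scalar_mxM za.
have azM : (1%:M - a) *m z%:M = 1%:M by rewrite aE -raddfB /= -scalar_mxM az.
(* Solving the first row for [y0] and substituting leaves a smaller system for [y1]. Its matrix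
   [D + c z b] keeps its entries in [I], which is closed under right multiplication. *)
have sysE (y0 : 'M_(1, 1)) (y1 : 'M_(n, 1)) :
    col_mx y0 y1 = col_mx v0 v1 + block_mx a b c D *m col_mx y0 y1 <->
    y0 = z%:M *m (v0 + b *m y1) /\
    y1 = (v1 + c *m (z%:M *m v0)) + (D + c *m (z%:M *m b)) *m y1.
  rewrite mul_block_col add_col_mx.
  have E0 : y0 = v0 + (a *m y0 + b *m y1) <-> y0 = z%:M *m (v0 + b *m y1).
    split=> [yE|yE].
      have <- : (1%:M - a) *m y0 = v0 + b *m y1.
        by rewrite mulmxBl mul1mx {1}yE addrCA addrAC subrr add0r.
      by rewrite mulmxA zaM mul1mx.
    have : (1%:M - a) *m y0 = v0 + b *m y1 by rewrite yE mulmxA azM mul1mx.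
    by rewrite mulmxBl mul1mx => e; rewrite addrCA -e addrC subrK.
  have E1 : y0 = z%:M *m (v0 + b *m y1) ->
      v1 + (c *m y0 + D *m y1) =
      (v1 + c *m (z%:M *m v0)) + (D + c *m (z%:M *m b)) *m y1.
    move=> ->; rewrite !mulmxDr mulmxDl -!mulmxA -!addrA.
    by congr (_ + (_ + _)); rewrite addrC.
  split=> [/eq_col_mx[/E0 y0E y1E]|[y0E y1E]].
    by split=> //; rewrite {1}y1E E1.
  by congr col_mx; [apply/E0|rewrite E1].
have [|y1 [y1E y1u]] := IH (D + c *m (z%:M *m b)) (v1 + c *m (z%:M *m v0)).
  move=> i j; rewrite !mxE; apply: ID; first exact: MI.
  by rewrite big_ord1; apply: IMr; rewrite !mxE; apply: MI.
exists (col_mx (z%:M *m (v0 + b *m y1)) y1); split; first exact/sysE.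
move=> y; rewrite -(vsubmxK y) => /sysE[-> yE].
by rewrite -(y1u _ yE).
Qed.

End LinearSystems.

(** * Rational series *)

Section RationalSeries.
Variable X : finType.
Local Notation R := (ratseries X).
Implicit Types (f g : R) (x : X).

HB.instance Definition _ :=
  GRing.RMorphism.copy (@ratval X) (val : R -> ncseries X).

Definition rateps f : int := ratval f [::].

Lemma ratderiv_subproof x f : ncderiv [:: x] (ratval f) \in @rational X.
Proof.
case: f => f /= /rationalP[s sf]; apply/rationalP; exists s => m.
by rewrite ncderiv_cat; apply: sf.
Qed.

Definition ratderiv x f : R := RatSeries (ratderiv_subproof x f).

Lemma ncsum J (r : seq J) (F : J -> ncseries X) w :
  (\sum_(j <- r) F j) w = \sum_(j <- r) F j w.
Proof. by elim: r => [|j r IH]; rewrite ?big_nil // !big_cons ncD IH. Qed.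

Lemma rateps_is_zmod_morphism : zmod_morphism rateps.
Proof. by move=> f g; rewrite /rateps rmorphB. Qed.
HB.instance Definition _ := GRing.isZmodMorphism.Build R int rateps rateps_is_zmod_morphism.

Lemma rateps_is_monoid_morphism : monoid_morphism rateps.
Proof.
split=> [|f g]; rewrite /rateps; first by rewrite rmorph1.
by rewrite rmorphM; apply: ncmul_nil.
Qed.
HB.instance Definition _ := GRing.isMonoidMorphism.Build R int rateps rateps_is_monoid_morphism.

Lemma ratderiv_is_zmod_morphism x : zmod_morphism (ratderiv x).
Proof. move=> f g; apply: val_inj; rewrite [RHS]rmorphB.
by rewrite -[LHS]/(ncderiv [:: x] (ratval (f - g))) rmorphB. Qed.
HB.instance Definition _ x :=
  GRing.isZmodMorphism.Build R R (ratderiv x) (ratderiv_is_zmod_morphism x).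

(** The leading letter [x] of a word in the product comes from [f], unless [f] contributes the empty
    word. *)
Lemma ratderivM x f g :
  ratderiv x (f * g) = ratderiv x g *~ rateps f + ratderiv x f * g.
Proof.
apply: val_inj; rewrite rmorphD rmorphM raddfMz.
by rewrite -[LHS]/(ncderiv [:: x] (ratval (f * g))) rmorphM; apply: ncderiv_mul.
Qed.

Lemma ratderiv1 x : ratderiv x 1 = 0.
Proof. exact: val_inj. Qed.

Lemma ncderiv_var x y : ncderiv [:: y] (ncvar x) = (x == y)%:R :> ncseries X.
Proof.
apply/funext => w; rewrite /ncderiv /ncvar eqseq_cons eq_sym.
by case: eqP.
Qed.

Lemma ratderiv_var x y : ratderiv y (ratvar x) = (x == y)%:R.
Proof. by apply: val_inj; rewrite rmorph_nat /= ncderiv_var. Qed.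

Lemma rateps_var x : rateps (ratvar x) = 0.
Proof. by []. Qed.

Lemma ratseries_expand f :
  f = (rateps f)%:~R + \sum_x ratvar x * ratderiv x f.
Proof.
apply: val_inj; rewrite rmorphD rmorph_int rmorph_sum; apply/funext => w.
rewrite ncD ncMz ncsum; case: w => [|y w].
  rewrite big1 => [|x _]; first by rewrite mul1r addr0.
  by rewrite rmorphM [LHS]ncmul_nil mul0r.
have termE x : \val (ratvar x * ratderiv x f) (y :: w) =
    ((x == y)%:R * val (ratderiv x f) : ncseries X) w.
  by rewrite rmorphM [LHS]ncmul_cons mul0r add0r ncderiv_var.
rewrite [X in X + _]mul0r add0r (eq_bigr _ (fun x _ => termE x)).
rewrite (bigD1 y) //= big1 => [|x /negPf->]; first by rewrite eqxx mul1r addr0.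
by rewrite mul0r.
Qed.

Lemma ratseries_torsionfree k f : f *~ k = 0 -> k = 0 \/ f = 0.
Proof.
move=> fk; case: (eqVneq k 0) => [->|k0]; [by left|right].
apply: val_inj; apply/funext => w; have := congr1 (fun h => val h w) fk.
rewrite raddfMz ncMz /= => /eqP; rewrite mulf_eq0 (negPf k0) orbF => /eqP ->.
by [].
Qed.

(** The module of all [D f] is stable under derivation because operators compose, and contains [f]
    because the identity is an operator. Its finite generating family [s] therefore carries integer
    matrices [A x]. *)
Lemma ratseries_system f : exists n (s : 'cV[R]_n) (A : X -> 'M[int]_n) (a : 'rV[int]_n),
  (forall x, map_mx (ratderiv x) s = map_mx intr (A x) *m s) /\
  f%:M = map_mx intr a *m s.
Proof.
case: f => f rf; move/asboolP: (rf) => [n [s sE]].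
have ratD D : deriv_ring D -> D f \in @rational X.
  move=> rD; apply/rationalP; case/rationalP: (rf) => t ft; exists t => m.
  by apply: deriv_ring_span => //; apply: zspan_closed.
have sP (i : 'I_n) : exists2 D, deriv_ring D & D f = s`_i.
  have : [set v | inIntSpan s v]%classic s`_i; last by rewrite -sE => -[D rD Df]; exists D.
  exists [ffun j => (j == i)%:Z]; rewrite (bigD1 i) //= ffunE eqxx mulr1z.
  by rewrite big1 ?addr0 // => j ji; rewrite ffunE (negPf ji) mulr0z.
have rs (i : 'I_n) : s`_i \in @rational X by have [D /ratD + <-] := sP i.
have spanE D : deriv_ring D ->
    exists a : {ffun 'I_n -> int}, D f = \sum_(i < n) s`_i *~ a i.
  by move=> rD; have : [set D f | D in @deriv_ring X]%classic (D f);
    [exists D | rewrite sE].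
pose sR : 'cV[R]_n := \col_i RatSeries (rs i).
have /choice[A AE] xi : exists a : {ffun 'I_n -> int},
    ncderiv [:: xi.1] s`_(xi.2 : 'I_n) = \sum_(i < n) s`_i *~ a i.
  have [D rD <-] := sP xi.2; apply: (spanE (ncderiv [:: xi.1] \o D)).
  by apply: DerivRing_comp => //; apply: DerivRing_deriv.
have [a aE] := spanE _ (DerivRing_id X).
exists n, sR, (fun x => \matrix_(i, j) A (x, i) j), (\row_j a j); split=> [x|].
  apply/matrixP => i j; rewrite !mxE; apply: val_inj.
  rewrite rmorph_sum -[LHS]/(ncderiv [:: x] s`_i) (AE (x, i)); apply: eq_bigr => k _.
  by rewrite !mxE mulrzl raddfMz.
rewrite [LHS]mx11_scalar; apply/matrixP => i j; rewrite !ord1 !mxE eqxx mulr1n.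
apply: val_inj; rewrite rmorph_sum -[LHS]/(id f) aE; apply: eq_bigr => k _.
by rewrite !mxE mulrzl raddfMz.
Qed.

(** * The star of a proper series and the Jacobson radical *)

Fixpoint ncstar_approx (p : ncseries X) n : ncseries X :=
  if n is n'.+1 then 1 + p * ncstar_approx p n' else 1.

(** For [p] without constant term, [p^k] has no word shorter than [k], so the partial sum up to
    exponent [size w] already has the final coefficient at [w]. *)
Definition ncstar (p : ncseries X) : ncseries X := fun w => ncstar_approx p (size w) w.

Lemma ncmul_proper_eq (p q r : ncseries X) w : p [::] = 0 ->
  (forall u, (size u < size w)%N -> q u = r u) -> (p * q) w = (p * r) w.
Proof.
move=> p0 qr; apply: eq_bigr => i _.
case: (posnP i) => [->|i0]; first by rewrite take0 p0 !mul0r.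
congr (_ * _); apply: qr; rewrite size_drop ltn_subrL i0 /=.
by apply: leq_trans i0 _; rewrite -ltnS.
Qed.

Lemma ncmul_proper_nil (p q : ncseries X) : p [::] = 0 -> (p * q) [::] = 0.
Proof. by move=> p0; rewrite [LHS]ncmul_nil p0 mul0r. Qed.

Lemma ncstarE (p : ncseries X) : p [::] = 0 -> ncstar p = 1 + p * ncstar p.
Proof.
move=> p0.
have stab n m w : (size w <= n)%N -> (size w <= m)%N ->
    ncstar_approx p n w = ncstar_approx p m w.
  elim: n m w => [|n IH] [|m] [|x w] // wn wm; rewrite /= ?ncD.
  - by rewrite ncmul_proper_nil ?addr0.
  - by rewrite ncmul_proper_nil ?addr0.
  - by rewrite !ncmul_proper_nil.
  - congr (_ + _); apply: ncmul_proper_eq => // u uw.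
    by apply: IH; rewrite -ltnS; apply: leq_trans uw _.
(* With index [(size w).+1] the approximant unfolds to [1 + p * ncstar_approx p (size w)]. *)
apply/funext => w; rewrite [LHS](stab _ (size w).+1) //= !ncD; congr (_ + _).
by apply: ncmul_proper_eq => // u uw; apply/stab => //; apply: ltnW.
Qed.

(** As [p] is proper, [d_x q = (d_x p) q], so the derivatives of [q] by nonempty words lie in the
    span of the products [u q] with [u] in [s]. *)
Lemma ncstar_rational (p : ncseries X) : p [::] = 0 -> p \in @rational X -> ncstar p \in @rational X.
Proof.
move=> p0 /rationalP[s sp]; set q := ncstar p.
have qE : q = 1 + p * q := ncstarE p0.
have dq x : ncderiv [:: x] q = ncderiv [:: x] p * q.
  have d1 : ncderiv [:: x] (1 : ncseries X) = 0 by [].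
  rewrite {1}qE -[LHS]/(ncderiv [:: x] (1 : ncseries X) + ncderiv [:: x] (ncmul p q)).
  by rewrite ncderiv_mul d1 p0 mulr0z !add0r.
have sq h : zspan s h -> zspan [seq u * q | u <- s] (h * q).
  apply: (zspan_sub (A := [set f | zspan _ (f * q)]%classic)) => [|u us /=].
    split=> /=; first by rewrite mul0r; apply: zspan0.
    by move=> u v su sv; rewrite mulrBl; apply: zspanB.
  by apply: mem_zspan; apply: map_f.
pose t := [seq u * q | u <- s].
(* By the Leibniz rule [d_x (h q)] combines [(d_x p) q] and [(d_x h) q], whose left factors satisfy
   the same condition as [h]; hence the induction on [m] keeps [h] general. *)
have tdm m h : (forall m, zspan s (ncderiv m h)) -> zspan t (ncderiv m (h * q)).
  elim: m h => [|x m IH] h sh; first exact/sq/(sh [::]).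
  rewrite -cat1s -ncderiv_cat -[h * q]/(ncmul h q) ncderiv_mul dq.
  have -> : ncderiv m ((ncderiv [:: x] p * q) *~ h [::] + ncmul (ncderiv [:: x] h) q)
      = ncderiv m (ncderiv [:: x] p * q) *~ h [::] + ncderiv m (ncderiv [:: x] h * q).
    by apply/funext => w; rewrite /ncderiv !ncD !ncMz.
  have cl := zspan_closed t.
  apply: zclosedD => //; last by apply: IH => n; rewrite ncderiv_cat.
  by apply: zclosedMz => //; apply: IH => n; rewrite ncderiv_cat.
apply/rationalP; exists (q :: t) => -[|x m].
  by apply: mem_zspan; rewrite inE eqxx.
rewrite -(cat1s x m) -ncderiv_cat dq -(cat1s q); apply: zspan_catr; apply: tdm => n.
by rewrite ncderiv_cat.
Qed.

(** The star of [1 - h] is a right inverse of [h], again with constant term 1. So the right inverse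
    of [f] has a right inverse itself, which must be [f]. *)
Lemma ratseries_left_inverse f : rateps f = 1 -> exists g, g * f = 1.
Proof.
have rinv h : rateps h = 1 -> exists2 g, h * g = 1 & rateps g = 1.
  move=> h1; have [p pE] : exists p : R, p = 1 - h by exists (1 - h).
  have p0 : rateps p = 0 by rewrite pE rmorphB rmorph1 /= h1 subrr.
  have [g gE] : exists g : R, g = 1 + p * g.
    exists (RatSeries (ncstar_rational p0 (valP p))).
    by apply: val_inj; rewrite rmorphD rmorphM /=; apply: ncstarE.
  exists g; last by rewrite gE rmorphD rmorphM rmorph1 /= p0 mul0r addr0.
  move/eqP: gE; rewrite -subr_eq -[X in X - _]mul1r -mulrBl pE subKr.
  by move/eqP.
move=> /rinv[g fg /rinv[h gh _]]; exists g.
by rewrite -[RHS]gh -[h]mul1r -fg -mulrA gh mulr1.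
Qed.

(** For radical [f], both [1 + f] and [1 - f] are left invertible, so [1 + eps f] and [1 - eps f]
    are units of Z, forcing [eps f = 0]. Conversely, if [eps f = 0] then [1 - r f] is left
    invertible and lies in no proper left ideal. *)
Lemma jacobson_ratseries f : jacobson (ratseries X) f <-> rateps f = 0.
Proof.
split=> [Jf|f0 I [[I0 I1 Ilin] Imax]].
  have unit1 (h : R) : jacobson (ratseries X) h -> `|1 + rateps h| = 1 :> int.
    move=> Jh; have [c _ ch] := jacobson_linv Jh.
    have /(congr1 rateps) : (1 + c) * (1 + h) = 1.
      by rewrite mulrDl mul1r mulrDr mulr1 -addrA [h + _]addrC [c + _]addrC ch addr0.
    rewrite rmorphM !rmorphD !rmorph1 => /(congr1 (fun k : int => `|k|%N)).
    rewrite abszM => /eqP; rewrite muln_eq1 => /andP[_ /eqP h1].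
    by rewrite -abszE h1.
  have := unit1 _ Jf; have := unit1 _ (jacobsonN Jf); rewrite rmorphN /=.
  move: (rateps f) => k; clear; lia.
case: (boolP (f \in I)) => // fI; exfalso.
(* [K] is the left ideal [I + R f]; were it proper, maximality would put [f] in [I]. *)
pose K : {pred R} := [pred h | `[< exists r, h - r * f \in I >]].
have KE h : reflect (exists r, h - r * f \in I) (h \in K) by apply: asboolP.
have K1 : 1 \in K.
  apply/negPn/negP => nK1; move/negP: fI; apply.
  apply: (Imax K); first split=> //.
  - by apply/KE; exists 0; rewrite mul0r subr0.
  - move=> r u v /KE[a ua] /KE[b vb]; apply/KE; exists (r * a + b).
    have -> : r * u + v - (r * a + b) * f = r * (u - a * f) + (v - b * f).
      by rewrite mulrBr mulrDl opprD addrACA mulrA.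
    exact: Ilin.
  - by move=> h hI; apply/KE; exists 0; rewrite mul0r subr0.
  - by apply/KE; exists 1; rewrite mul1r subrr.
have [r /= rf] := KE _ K1.
have [|g g1] := @ratseries_left_inverse (1 - r * f).
  by rewrite rmorphB rmorphM rmorph1 /= f0 mulr0 subr0.
by move/negP: I1; apply; rewrite -g1 -[_ * _]addr0; apply: Ilin.
Qed.

End RationalSeries.

(** * Realization of rational series in a ring with a radical ideal *)

Section Realization.
Variables (X : finType) (U : nzRingType) (I : U -> Prop) (xi : X -> U).
Hypothesis I0 : I 0.
Hypothesis ID : forall a b, I a -> I b -> I (a + b).
Hypothesis IMr : forall a b, I a -> I (a * b).
Hypothesis Iinv : forall a, I a -> exists2 b, b * (1 - a) = 1 & (1 - a) * b = 1.
Hypothesis Ixi : forall x, I (xi x).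
Local Notation R := (ratseries X).
Implicit Types (f g : R) (x : X).

Notation intr_mx V := (map_mx (intr : int -> V)).

Definition system_mx m n (A : X -> 'M[int]_(m, n)) : 'M[U]_(m, n) :=
  \sum_x xi x *: intr_mx U (A x).

Lemma system_mx_in m n (A : X -> 'M[int]_(m, n)) : mx_in I (system_mx A).
Proof.
move=> i j; rewrite summxE; apply: big_ind => // x _.
by rewrite !mxE; apply: IMr.
Qed.

Lemma derivation_rigid (delta : {additive R -> U}) :
  (forall f, delta f = \sum_x xi x * delta (ratderiv x f)) -> forall f, delta f = 0.
Proof.
move=> deltaE f; have [n [s [A [a [sA fE]]]]] := ratseries_system f.
have [y [_ y_uniq]] := linear_system ID IMr Iinv 0 (system_mx_in A).
have y0 : y = 0 by apply: y_uniq; rewrite mulmx0 addr0.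
have ds : map_mx delta s = 0 + system_mx A *m map_mx delta s.
  rewrite add0r mulmx_suml; apply/colP => i; rewrite summxE mxE deltaE.
  apply: eq_bigr => x _; rewrite -scalemxAl mxE -map_raddf_mul -sA.
  by rewrite !mxE.
have := congr1 (fun B => map_mx delta B 0 0) fE.
by rewrite map_raddf_mul -(y_uniq _ ds) y0 mulmx0 !mxE eqxx mulr1n.
Qed.

Lemma system_mx_mulr m n p (A : X -> 'M[int]_(m, n)) (P : 'M[int]_(n, p)) :
  system_mx A *m intr_mx U P = system_mx (fun x => A x *m P).
Proof.
by rewrite mulmx_suml; apply: eq_bigr => x _; rewrite -scalemxAl map_mxM.
Qed.

Lemma system_mx_mull m n p (A : X -> 'M[int]_(n, p)) (P : 'M[int]_(m, n)) :
  intr_mx U P *m system_mx A = system_mx (fun x => P *m A x).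
Proof.
rewrite mulmx_sumr; apply: eq_bigr => x _; apply/matrixP => i j.
rewrite map_mxM !mxE mulr_sumr; apply: eq_bigr => k _.
by rewrite !mxE !mulrA; congr (_ * _); rewrite mulrzl mulrzr.
Qed.

Definition stable n (s : 'cV[R]_n) (A : X -> 'M[int]_n) :=
  forall x, map_mx (ratderiv x) s = intr_mx R (A x) *m s.

Definition solves n (s : 'cV[R]_n) A (y : 'cV[U]_n) :=
  y = intr_mx U (map_mx (@rateps X) s) + system_mx A *m y.

Lemma exists_solves n (s : 'cV[R]_n) A : exists y, solves s A y.
Proof.
have [y [yE _]] := linear_system ID IMr Iinv
  (intr_mx U (map_mx (@rateps X) s)) (system_mx_in A).
by exists y.
Qed.

Lemma solves_uniq n (s : 'cV[R]_n) A y z : solves s A y -> solves s A z -> y = z.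
Proof.
have [t [_ t_uniq]] := linear_system ID IMr Iinv
  (intr_mx U (map_mx (@rateps X) s)) (system_mx_in A).
by move=> /t_uniq <- /t_uniq <-.
Qed.

Lemma int_free_inj m n (u : 'cV[R]_n) (M N : 'M[int]_(m, n)) :
  int_free u -> intr_mx R M *m u = intr_mx R N *m u -> M = N.
Proof.
move=> ufree MN; apply/row_matrixP => i; apply/eqP; rewrite -subr_eq0; apply/eqP.
apply: ufree; rewrite -linearB /= map_row -row_mul map_mxB mulmxBl MN subrr.
by rewrite row0.
Qed.

(** The matrices [A] of a dependent family are not determined by it, so the relation is moved to a
    Z-basis [u] with [s = P u]. If [z] solves the system of [u], uniqueness gives [y = P z];
    freeness turns [a s = 0] into [a P = 0], hence [a y = 0]. *)
Lemma solves_relation n (s : 'cV[R]_n) A y (a : 'rV[int]_n) :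
  stable s A -> solves s A y -> intr_mx R a *m s = 0 -> intr_mx U a *m y = 0.
Proof.
move=> sA sy as0.
have [m [u [P [Q [ufree sE uE]]]]] := int_basis s (@ratseries_torsionfree X).
pose C x := Q *m A x *m P.
have uC : stable u C.
  by move=> x; rewrite {1}uE map_raddf_mul sA {1}sE !map_mxM !mulmxA.
(* Both sides give the coordinates of the derivatives of [s] in the basis [u]. *)
have PC : (fun x => P *m C x) = (fun x => A x *m P).
  apply/funext => x; apply: (int_free_inj ufree).
  by rewrite !map_mxM -!mulmxA -sE -sA {2}sE map_raddf_mul uC /C !map_mxM -!mulmxA -sE sA.
have [z zE] := exists_solves u C.
have -> : y = intr_mx U P *m z.
  apply: solves_uniq sy _; rewrite /solves {1}zE mulmxDr.
  rewrite !mulmxA system_mx_mull PC system_mx_mulr; congr (_ + _).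
  rewrite [in RHS]sE map_raddf_mul map_mxM; congr (map_mx _ _ *m _).
  by apply/matrixP => i j; rewrite mxE intz.
have aP : a *m P = 0.
  by apply: ufree; rewrite map_mxM -mulmxA -sE.
by rewrite mulmxA -map_mxM aP map_mx0 mul0mx.
Qed.

(** The graph of the future [Psi], kept as a relation until independence of the representation is
    known. *)
Definition realizes f (v : U) := exists n (s : 'cV[R]_n) A y (a : 'rV[int]_n),
  [/\ stable s A, solves s A y, f%:M = intr_mx R a *m s & v%:M = intr_mx U a *m y].

Lemma realizes_total f : exists v, realizes f v.
Proof.
have [n [s [A [a [sA fE]]]]] := ratseries_system f.
have [y sy] := exists_solves s A.
exists ((intr_mx U a *m y) 0 0), n, s, A, y, a; split=> //.
by rewrite -mx11_scalar.
Qed.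

(** Stack the two families; block-diagonal matrices keep their systems separate. *)
Lemma realizes_common f g v w : realizes f v -> realizes g w ->
  exists n (s : 'cV[R]_n) A y (a b : 'rV[int]_n), [/\ stable s A, solves s A y,
    f%:M = intr_mx R a *m s /\ v%:M = intr_mx U a *m y &
    g%:M = intr_mx R b *m s /\ w%:M = intr_mx U b *m y].
Proof.
move=> [m [s [A [y [a [sA sy fE vE]]]]]] [n [t [B [z [b [tB tz gE wE]]]]]].
pose C x := block_mx (A x) 0 0 (B x).
exists (m + n)%N, (col_mx s t), C, (col_mx y z), (row_mx a 0), (row_mx 0 b); split.
- move=> x; rewrite map_col_mx sA tB map_block_mx mul_block_col !map_mx0.
  by rewrite !mul0mx addr0 add0r.
- have CE : system_mx C = block_mx (system_mx A) 0 0 (system_mx B).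
    rewrite /system_mx; elim/big_rec3: _ => [|x M N S _ ->]; first by rewrite block_mx0.
    by rewrite map_block_mx !map_mx0 scale_block_mx !scaler0 add_block_mx !addr0.
  rewrite /solves CE mul_block_col !mul0mx addr0 add0r !map_col_mx add_col_mx.
  by congr col_mx; [apply: sy | apply: tz].
- by rewrite !map_row_mx !mul_row_col !map_mx0 !mul0mx !addr0.
- by rewrite !map_row_mx !mul_row_col !map_mx0 !mul0mx !add0r.
Qed.

(** Over a common family the two coefficient rows differ by a relation of [s], which [y]
    inherits. *)
Lemma realizes_uniq f v w : realizes f v -> realizes f w -> v = w.
Proof.
move=> fv fw; have [n [s [A [y [a [b [sA sy [fa va] [fb wb]]]]]]]] := realizes_common fv fw.
have : intr_mx R (a - b) *m s = 0 by rewrite map_mxB mulmxBl -fa -fb subrr.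
move=> /(solves_relation sA sy); rewrite map_mxB mulmxBl -va -wb -raddfB.
by move/matrixP => /(_ 0 0); rewrite !mxE eqxx mulr1n => /eqP; rewrite subr_eq0 => /eqP.
Qed.

Lemma realizesB f g v w : realizes f v -> realizes g w -> realizes (f - g) (v - w).
Proof.
move=> fv gw; have [n [s [A [y [a [b [sA sy [fa va] [gb wb]]]]]]]] := realizes_common fv gw.
by exists n, s, A, y, (a - b); rewrite !map_mxB !mulmxBl !raddfB /= fa va gb wb.
Qed.

(** The same family represents [ratderiv x f], with row [a *m A x]; multiply the system for [y] by
    [a]. *)
Lemma realizes_step f v (w : X -> U) : realizes f v ->
  (forall x, realizes (ratderiv x f) (w x)) ->
  v = (rateps f)%:~R + \sum_x xi x * w x.
Proof.
move=> [n [s [A [y [a [sA sy fE vE]]]]]] fw.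
have wE x : (w x)%:M = intr_mx U (a *m A x) *m y.
  have fx : realizes (ratderiv x f) ((intr_mx U (a *m A x) *m y) 0 0).
    exists n, s, A, y, (a *m A x); split=> //; last by rewrite -mx11_scalar.
    rewrite map_mxM -mulmxA -sA -map_raddf_mul -fE.
    by apply/matrixP => i j; rewrite !ord1 !mxE eqxx !mulr1n.
  by rewrite (realizes_uniq (fw x) fx) -mx11_scalar.
have epsE : (rateps f)%:M = map_mx intr a *m map_mx (@rateps X) s.
  rewrite -map_raddf_mul -fE.
  by apply/matrixP => i j; rewrite !ord1 !mxE eqxx !mulr1n.
have : v%:M = ((rateps f)%:~R + \sum_x xi x * w x)%:M :> 'M_1.
  rewrite vE {1}sy mulmxDr mulmxA system_mx_mull mulmx_suml raddfD raddf_sum /=.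
  congr (_ + _).
    rewrite -map_scalar_mx epsE map_mxM; congr (map_mx _ _ *m _).
    by apply/matrixP => i j; rewrite !mxE intz.
  by apply: eq_bigr => x _; rewrite -scalemxAl -wE -mul_scalar_mx -scalar_mxM.
by move/matrixP => /(_ 0 0); rewrite !mxE eqxx !mulr1n.
Qed.

Lemma exists_realization : exists Psi : {additive R -> U},
  forall f, Psi f = (rateps f)%:~R + \sum_x xi x * Psi (ratderiv x f).
Proof.
have [Psi PsiP] := choice realizes_total.
have PsiB : zmod_morphism Psi.
  by move=> f g; apply: realizes_uniq (PsiP _) _; apply: realizesB.
pose Psi' : {additive R -> U} := HB.pack Psi (GRing.isZmodMorphism.Build R U Psi PsiB).
by exists Psi' => f; apply: realizes_step.
Qed.

Section Multiplicativity.
Variable Psi : {additive R -> U}.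
Hypothesis PsiE : forall f, Psi f = (rateps f)%:~R + \sum_x xi x * Psi (ratderiv x f).

Lemma realization_var x : Psi (ratvar x) = xi x.
Proof.
rewrite PsiE rateps_var add0r (bigD1 x) //= big1 => [|y /negPf yx].
  rewrite ratderiv_var eqxx PsiE rmorph1 big1 ?addr0 ?mulr1 // => y _.
  by rewrite ratderiv1 raddf0 mulr0.
by rewrite ratderiv_var eq_sym yx raddf0 mulr0.
Qed.

Lemma realizationM f g : Psi (f * g) = Psi f * Psi g.
Proof.
pose delta f := Psi (f * g) - Psi f * Psi g.
have deltaB : zmod_morphism delta.
  by move=> h k; rewrite /delta mulrBl !raddfB /= mulrBl !opprD !opprK addrACA.
pose delta' : {additive R -> U} :=
  HB.pack delta (GRing.isZmodMorphism.Build R U delta deltaB).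
apply/eqP; rewrite -subr_eq0; apply/eqP.
apply: (derivation_rigid (delta := delta')) => {}f; rewrite /= /delta.
(* Expanding [Psi g] once accounts for the constant term of [f * g] and for the terms of the Leibniz
   rule that carry [rateps f]. *)
have -> : Psi (f * g) = Psi g *~ rateps f + \sum_x xi x * Psi (ratderiv x f * g).
  rewrite PsiE [Psi g in RHS]PsiE mulrzDl mulrz_suml -addrA -big_split.
  rewrite (rmorphM (@rateps X)) [rateps f * _]mulrC intrM mulrzr; congr (_ + _).
  by apply: eq_bigr => x _ /=; rewrite ratderivM raddfD raddfMz mulrDr mulrzAr.
rewrite [Psi f]PsiE mulrDl mulrzl opprD addrACA subrr add0r mulr_suml -sumrB.
by apply: eq_bigr => x _; rewrite mulrBr mulrA.
Qed.

End Multiplicativity.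

End Realization.

(** * The unital ring of a two-sided skew brace of abelian type *)

Section Dorroh.
Variables (V : zmodType) (op : V -> V -> V).
Hypothesis opA : associative op.
Hypothesis opDl : left_distributive op +%R.
Hypothesis opDr : right_distributive op +%R.

Lemma morphD_zmod_morphism (A B : zmodType) (h : A -> B) :
  {morph h : a b / a + b} -> zmod_morphism h.
Proof. by move=> hD a b; apply/eqP; rewrite eq_sym subr_eq -hD subrK. Qed.

Lemma op_zmodr a : zmod_morphism (op a).
Proof. exact/morphD_zmod_morphism/opDr. Qed.

Lemma op_zmodl b : zmod_morphism (op ^~ b).
Proof. by apply: morphD_zmod_morphism => a c; apply: opDl. Qed.

Let opr a : {additive V -> V} :=
  HB.pack (op a) (GRing.isZmodMorphism.Build V V (op a) (op_zmodr a)).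
Let opl b : {additive V -> V} :=
  HB.pack (op ^~ b) (GRing.isZmodMorphism.Build V V (op ^~ b) (op_zmodl b)).

Lemma op0r b : op 0 b = 0. Proof. exact: raddf0 (opl b). Qed.
Lemma opr0 a : op a 0 = 0. Proof. exact: raddf0 (opr a). Qed.
Lemma opMzl a b k : op (a *~ k) b = op a b *~ k. Proof. exact: (raddfMz (opl b)). Qed.
Lemma opMzr a b k : op a (b *~ k) = op a b *~ k. Proof. exact: (raddfMz (opr a)). Qed.

(* [(k, a)] stands for [k + a], which adjoins a unit to the ring [(V, +, op)]. *)
Definition dorroh of associative op & left_distributive op +%R
  & right_distributive op +%R : Type := (int * V)%type.
Local Notation D := (dorroh opA opDl opDr).

HB.instance Definition _ := GRing.Zmodule.copy D (int * V)%type.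

Definition dorroh_mul (u v : D) : D :=
  (u.1 * v.1, v.2 *~ u.1 + u.2 *~ v.1 + op u.2 v.2).
Definition dorroh_one : D := (1, 0).

Lemma dorroh_mulA : associative dorroh_mul.
Proof.
move=> [k a] [l b] [m c]; congr (_, _) => /=; first exact: mulrA.
rewrite !opDr !opDl !mulrzDl !opMzl !opMzr opA -!mulrzA !addrA.
by rewrite [LHS](ACl (1*2*4*6*3*5*7)) /= [l * k]mulrC [m * k]mulrC.
Qed.

Lemma dorroh_mul1 : left_id dorroh_one dorroh_mul.
Proof. by move=> [k a]; rewrite /dorroh_mul /= mul1r mul0rz addr0 op0r addr0. Qed.

Lemma dorroh_mulr1 : right_id dorroh_one dorroh_mul.
Proof. by move=> [k a]; rewrite /dorroh_mul /= mulr1 mul0rz add0r opr0 addr0. Qed.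

Lemma dorroh_mulDl : left_distributive dorroh_mul +%R.
Proof.
move=> [k a] [l b] [m c]; congr (_, _) => /=; first exact: mulrDl.
rewrite opDl mulrzDl mulrzDr !addrA.
by rewrite [LHS](ACl (1*3*5*2*4*6)).
Qed.

Lemma dorroh_mulDr : right_distributive dorroh_mul +%R.
Proof.
move=> [k a] [l b] [m c]; congr (_, _) => /=; first exact: mulrDr.
rewrite opDr mulrzDl mulrzDr !addrA.
by rewrite [LHS](ACl (1*3*5*2*4*6)).
Qed.

Lemma dorroh_one_neq0 : dorroh_one != 0.
Proof. by apply/eqP => /(congr1 fst). Qed.

HB.instance Definition _ := GRing.Zmodule_isNzRing.Build D
  dorroh_mulA dorroh_mul1 dorroh_mulr1 dorroh_mulDl dorroh_mulDr dorroh_one_neq0.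

Lemma dorroh_int k : k%:~R = (k, 0) :> D.
Proof.
have natE n : n%:R = (n%:Z, 0) :> D.
  elim: n => [|n IH] //; rewrite -addn1 natrD IH.
  by congr (_, _); rewrite /= ?addr0 // PoszD.
case: k => n; first by rewrite -pmulrn natE.
by rewrite NegzE mulrNz -pmulrn natE; congr (_, _); rewrite /= ?oppr0.
Qed.

(** The inverse of [1 - a] is [1 + b] with [b] the quasi-inverse of [- a]. *)
Lemma dorroh_unipotent (a : D) :
  (forall v : V, exists2 w, w + v + op w v = 0 & v + w + op v w = 0) ->
  a.1 = 0 -> exists2 b : D, b * (1 - a) = 1 & (1 - a) * b = 1.
Proof.
case: a => k a quasi /= ->; have [b ba ab] := quasi (- a).
have aE : 1 - ((0, a) : D) = (1, - a) by congr (_, _); rewrite /= ?subr0 ?add0r.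
exists ((1, b) : D); rewrite aE; congr (_, _); rewrite /= ?mulr1 // !mulr1z.
  by rewrite [- a + b]addrC.
by rewrite [b - a]addrC.
Qed.

End Dorroh.

(** * The radical ring of a brace *)

Section BraceRing.
Variables (K : skewBrace) (Kab : abelian_type K).

(** Commutativity is a parameter of the type, so that the abelian group structure can be attached to
    it. *)
Definition brace_zmod of abelian_type K : Type := K.
Local Notation V := (brace_zmod Kab).

HB.instance Definition _ := gen_eqMixin V.
HB.instance Definition _ := gen_choiceMixin V.

Lemma brace_addA : associative (@sb_add K). Proof. by case: (sb_add_group K). Qed.
Lemma brace_add0 : left_id (sb_zero K) (@sb_add K). Proof. by case: (sb_add_group K). Qed.
Lemma brace_addN : left_inverse (sb_zero K) (@sb_opp K) (@sb_add K).
Proof. by case: (sb_add_group K). Qed.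

HB.instance Definition _ := GRing.isZmodule.Build V
  brace_addA Kab brace_add0 brace_addN.

Definition brace_circ (a b : V) : V := sb_circ a b.
Definition brace_mul (a b : V) : V := brace_circ a b - a - b.

Lemma brace_circE a b : brace_circ a b = a + b + brace_mul a b.
Proof. by rewrite /brace_mul addrC -[X in X + _]addrA -opprD subrK. Qed.

Lemma brace_mulDr : right_distributive brace_mul +%R.
Proof.
move=> a b c; rewrite /brace_mul.
have -> : brace_circ a (b + c) = brace_circ a b - a + brace_circ a c by apply: sb_circDr.
by rewrite opprD !addrA [LHS](ACl (1*2*5*3*4*6)).
Qed.

Lemma brace_circA : associative brace_circ.
Proof. by case: (sb_circ_group K). Qed.

(** Compute the circle product of [sb_one K] and 0 both by neutrality and by [brace_circE]. *)
Lemma brace_one : sb_one K = 0 :> V.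
Proof.
have [_ circ1 _ _ _] := sb_circ_group K.
have := brace_circE (sb_one K) 0.
by rewrite (opr0 brace_mulDr) !addr0 [LHS]circ1 => ->.
Qed.

Hypothesis K2 : two_sided K.

Lemma brace_mulDl : left_distributive brace_mul +%R.
Proof.
move=> b c a; rewrite /brace_mul.
have -> : brace_circ (b + c) a = brace_circ b a - a + brace_circ c a by apply: K2.
by rewrite opprD !addrA [LHS](ACl (1*4*2*3*5*6)).
Qed.

(** Expanding associativity of the circle operation by distributivity, six terms cancel and only the
    triple products remain. *)
Lemma brace_mulA : associative brace_mul.
Proof.
move: brace_circA brace_circE brace_mulDl brace_mulDr.
move: brace_mul brace_circ => m o oA oE mDl mDr a b c; have := oA a b c.
rewrite !oE !mDl !mDr !addrA [RHS](ACl (1*2*4*6*3*5*7)) /=; exact: addrI.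
Qed.

Lemma brace_quasi_inverse (v : V) :
  exists2 w, w + v + brace_mul w v = 0 & v + w + brace_mul v w = 0.
Proof.
have [_ _ _ invl invr] := sb_circ_group K.
by exists (sb_inv v : V); rewrite -brace_circE -brace_one; [apply: invl|apply: invr].
Qed.

End BraceRing.

Lemma jacobson_two_sided (R : nzRingType) : two_sided (jacobson_brace R).
Proof.
move=> a b c; apply: val_inj => /=; rewrite mulrDl addrK !addrA.
by rewrite [LHS](ACl (1*3*2*4*5)).
Qed.

Lemma jacobson_abelian_type (R : nzRingType) : abelian_type (jacobson_brace R).
Proof. by move=> a b; apply: val_inj; apply: addrC. Qed.

(** * The universal property *)

Section UniversalProperty.
Variables (X : finType) (K : skewBrace) (K2 : two_sided K) (Kab : abelian_type K).
Local Notation R := (ratseries X).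
Local Notation J := (jacobson_brace R).
Variables (i : X -> J) (f : X -> K).
Hypothesis iE : forall x, val (i x : jacobson R) = ratvar x.

Local Notation V := (brace_zmod Kab).
Local Notation U := (dorroh (@brace_mulA K Kab K2) (@brace_mulDl K Kab K2) (@brace_mulDr K Kab)).

Definition dorroh_gen (x : X) : U := (0, f x : V).

Let I (u : U) := u.1 = 0.

Let I0 : I 0. Proof. by []. Qed.
Let ID a b : I a -> I b -> I (a + b).
Proof. by rewrite /I /= => -> ->. Qed.
Let IMr a b : I a -> I (a * b).
Proof. by rewrite /I /= => ->; rewrite mul0r. Qed.
Let Iinv a : I a -> exists2 b, b * (1 - a) = 1 & (1 - a) * b = 1.
Proof. by apply: dorroh_unipotent; apply: brace_quasi_inverse. Qed.
Let Igen x : I (dorroh_gen x). Proof. by []. Qed.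

(** Every [dorroh_gen x] has integer part 0, and so has any multiple of it. Thus [Psi] sends the
    Jacobson radical into the copy of [K]. *)
Lemma dorroh_fstE (Psi : {additive R -> U}) :
  (forall g, Psi g = (rateps g)%:~R + \sum_x dorroh_gen x * Psi (ratderiv x g)) ->
  forall g, (Psi g).1 = rateps g.
Proof.
move=> PsiE g; rewrite PsiE dorroh_int /= raddf_sum big1 ?addr0 // => x _ /=.
by rewrite mul0r.
Qed.

Lemma exists_brace_hom : exists phi : J -> K, skewBrace_hom phi /\ f = phi \o i.
Proof.
have [Psi PsiE] := exists_realization I0 ID IMr Iinv Igen.
have Psi1 := dorroh_fstE PsiE.
have J0 (a : J) : rateps (val (a : jacobson R)) = 0.
  by apply/jacobson_ratseries/jacobson_val.
exists (fun a : J => (Psi (val (a : jacobson R))).2); split; last first.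
  by apply/funext => x /=; rewrite iE (realization_var PsiE).
split=> a b /=; first by rewrite raddfD.
rewrite !raddfD (realizationM I0 ID IMr Iinv Igen PsiE) /= !Psi1 !J0 !mulr0z add0r add0r.
by rewrite -[RHS]/(brace_circ _ _) brace_circE addrAC.
Qed.

Lemma jacobson_proper (g : R) : jacobson R (g - (rateps g)%:~R).
Proof.
by apply/jacobson_ratseries; rewrite rmorphB rmorph_int intz subrr.
Qed.

Definition proper_part (g : R) : J := jacobson_sub (jacobson_proper g).

(* [phi] extends to the unital rings by [k + a |-> k + phi a]. *)
Definition unital_extension (phi : J -> K) (g : R) : U :=
  (rateps g, phi (proper_part g) : V).

(** The recursion is the image of [ratseries_expand], once the extension is known to be additive and
    to respect left multiplication by a variable. *)
Lemma unital_extension_rec (phi : J -> K) : skewBrace_hom phi -> f = phi \o i ->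
  zmod_morphism (unital_extension phi) /\
  forall g, unital_extension phi g =
    (rateps g)%:~R + \sum_x dorroh_gen x * unital_extension phi (ratderiv x g).
Proof.
move=> [phiD phiM] fE; set Phi := unital_extension phi.
have PhiB : zmod_morphism Phi.
  apply: morphD_zmod_morphism => g h; congr (_, _).
  rewrite -[RHS]phiD; congr phi; apply: val_inj.
  rewrite -[LHS]/(g + h - (rateps (g + h))%:~R) (rmorphD (@rateps X)) rmorphD opprD.
  exact: addrACA.
split=> // g.
pose Phi' : {additive R -> U} :=
  HB.pack Phi (GRing.isZmodMorphism.Build R U Phi PhiB).
have PhiD u v : Phi (u + v) = Phi u + Phi v := raddfD Phi' u v.
have PhiMz u k : Phi (u *~ k) = Phi u *~ k := raddfMz Phi' k u.
pose z : J := jacobson_zero R.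
have phi0 : (phi z : V) = 0.
  have zz : sb_add z z = z by apply: val_inj; apply: addr0.
  by apply: (@addrI V (phi z)); rewrite addr0 -[RHS](congr1 phi zz) phiD.
have PhiJ (a : J) : Phi (val (a : jacobson R)) = (0, phi a : V).
  have a0 : rateps (val (a : jacobson R)) = 0 by apply/jacobson_ratseries/jacobson_val.
  rewrite /Phi /unital_extension a0; congr (_, phi _).
  by apply: val_inj; rewrite /= a0 subr0.
have Phi1 : Phi 1 = 1.
  rewrite /Phi /unital_extension rmorph1; congr (_, _).
  by rewrite -[RHS]phi0; congr phi; apply: val_inj; rewrite /= rmorph1 subrr.
have PhiVar x : Phi (ratvar x) = dorroh_gen x by rewrite -iE PhiJ /dorroh_gen fE.
have PhiXJ x (a : J) : Phi (ratvar x * val (a : jacobson R)) =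
    dorroh_gen x * Phi (val (a : jacobson R)).
  (* The ring product is rewritten through the circle operation, which [phi] respects. *)
  have -> : ratvar x * val (a : jacobson R) =
      val (sb_circ (i x) a : jacobson R) - ratvar x - val (a : jacobson R).
    by rewrite /= iE addrAC addrK addrAC subrr add0r.
  rewrite !PhiB PhiVar !PhiJ phiM.
  congr (_, _); rewrite /= !mulr0z !add0r.
  by rewrite -[phi (i x)]/((phi \o i) x) -fE.
have PhiX x h : Phi (ratvar x * h) = dorroh_gen x * Phi h.
  have -> : h = (rateps h)%:~R + val (proper_part h : jacobson R).
    by rewrite addrC subrK.
  move: (rateps h) (proper_part h) => k p.
  by rewrite mulrDr !PhiD PhiXJ mulrzr !PhiMz Phi1 mulrDr mulrzr PhiVar.
rewrite -/(Phi g) [in LHS](ratseries_expand g) PhiD PhiMz Phi1; congr (_ + _).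
rewrite [LHS](raddf_sum Phi'); apply: eq_bigr => x _; exact: PhiX.
Qed.

(** Both unital extensions satisfy the same recursion, so [derivation_rigid] kills their difference;
    on the radical, [proper_part] is the identity. *)
Lemma brace_hom_unique (phi psi : J -> K) :
  skewBrace_hom phi -> f = phi \o i -> skewBrace_hom psi -> f = psi \o i -> phi = psi.
Proof.
move=> hphi fphi hpsi fpsi.
have [PhiB PhiE] := unital_extension_rec hphi fphi.
have [PsiB PsiE] := unital_extension_rec hpsi fpsi.
pose Phi : {additive R -> U} := HB.pack (unital_extension phi)
  (GRing.isZmodMorphism.Build R U (unital_extension phi) PhiB).
pose Psi : {additive R -> U} := HB.pack (unital_extension psi)
  (GRing.isZmodMorphism.Build R U (unital_extension psi) PsiB).
have PhiPsi g : (Phi \- Psi) g = 0.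
  apply: (derivation_rigid I0 ID IMr Iinv Igen (delta := Phi \- Psi)) => {}g.
  rewrite /= PhiE PsiE opprD addrACA subrr add0r -sumrB.
  by apply: eq_bigr => x _; rewrite mulrBr.
apply/funext => a.
have aE : a = proper_part (val (a : jacobson R)).
  apply: val_inj => /=; have /jacobson_ratseries -> := jacobson_val a.
  by rewrite subr0.
rewrite aE; apply: (congr1 snd (_ : Phi (val (a : jacobson R)) = Psi _)).
by apply/eqP; rewrite -subr_eq0; apply/eqP; apply: PhiPsi.
Qed.

End UniversalProperty.

Theorem theorem6p14 (X : finType) (hX : (0 < #|X|)%N) :
  exists i : X -> jacobson_brace (ratseries X),
    (forall x : X, val (i x : jacobson (ratseries X)) = ratvar x) /\
    free_two_sided_abelian i.
Proof.
have var_jacobson x : jacobson (ratseries X) (ratvar x) by apply/jacobson_ratseries.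
pose i x : jacobson_brace (ratseries X) := jacobson_sub (var_jacobson x).
have iE x : val (i x : jacobson (ratseries X)) = ratvar x by [].
exists i; split=> //; split.
- exact: jacobson_two_sided.
- exact: jacobson_abelian_type.
move=> K K2 Kab f; have [phi [hphi fphi]] := exists_brace_hom K2 Kab f iE.
exists phi; split=> // psi [hpsi fpsi].
exact: (brace_hom_unique K2 Kab iE hphi fphi hpsi fpsi).
Qed.
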